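(* In the setting described in the context, let $N\ge1$ and consider the primal linear program $$\max_{\theta\in\mathbb{R}^d}\ \theta^{\top}\langle\mu,\psi\rangle\quad\text{subject to}\quad Q^\theta(z(k-1))-c(z(k-1))-Q^\theta(x(k),u)\le 0,\quad 1\le k\le N,\ u\in\mathsf{U},$$ and its dual $$\min_{\varpi}\ \sum_{k=1}^N\sum_{u\in\mathsf{U}}\varpi_{k,u}\,c(z(k-1))\quad\text{subject to}\quad \sum_{k=1}^N\sum_{u\in\mathsf{U}}\varpi_{k,u}\{\psi(z(k-1))-\psi(x(k),u)\}=\langle\mu,\psi\rangle,$$ where the minimum is over all $\varpi=(\varpi_{k,u})$ with $\varpi_{k,u}\ge 0$ for each $1\le k\le N$, $u\in\mathsf{U}$. Suppose that $\theta^*$ is an optimizer of the primal and $\varpi^*$ is an optimizer of the dual. If $\varpi^*_{k^\circ,u^\circ}>0$ for some $1\le k^\circ\le N$ and $u^\circ\in\mathsf{U}$, then $$0=\min_{u\in\mathsf{U}}\bigl\{-Q^{\theta^*}(z(k^\circ-1))+c(z(k^\circ-1))+Q^{\theta^*}(x(k^\circ),u)\bigr\}$$ and $$u^\circ\in\operatorname*{arg\,min}_{u\in\mathsf{U}}Q^{\theta^*}(x(k^\circ),u).$$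
   Context: Setting. The state space $\mathsf{X}$ is a closed subset of $\mathbb{R}^n$, the input space $\mathsf{U}$ is a finite set, all inputs are admissible in every state, and $\mathsf{Z}=\mathsf{X}\times\mathsf{U}$. The dynamics are $x(k+1)=\mathrm{F}(x(k),u(k))$, $k\ge0$, with $\mathrm{F}:\mathsf{X}\times\mathsf{U}\to\mathsf{X}$, and $z(k)=(x(k),u(k))$ is a given (observed) input-state sequence. There is an equilibrium pair $z^e=(x^e,u^e)\in\mathsf{Z}$ with $x^e=\mathrm{F}(x^e,u^e)$. The cost function $c:\mathsf{Z}\to[0,\infty)$ satisfies $c(z^e)=0$. The basis is $\psi=(\psi_1,\dots,\psi_d):\mathsf{Z}\to\mathbb{R}^d$ with $\psi_i(z^e)=0$ for each $i$, and $Q^\theta(z)=\theta^{\top}\psi(z)$ for $\theta\in\mathbb{R}^d$. $\mu$ is a discrete probability measure on $\mathsf{Z}$, and $\langle\mu,\psi\rangle=\sum_z\mu(z)\psi(z)\in\mathbb{R}^d$ (assumed well defined). *)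

(* Defs.v *)
From HB Require Import structures.
From mathcomp Require Import all_boot all_order all_algebra.
From mathcomp Require Import all_classical all_reals all_analysis.

Set Implicit Arguments.
Unset Strict Implicit.
Unset Printing Implicit Defensive.

Import Order.TTheory GRing.Theory Num.Theory.
Import numFieldNormedType.Exports.

Local Open Scope classical_set_scope.
Local Open Scope ring_scope.

Section Optimization.
Context {R : realType} {T : Type}.

Definition is_min (A : set R) (m : R) : Prop := A m /\ lbound A m.

Definition argmin (A : set T) (f : T -> R) : set T :=
  [set x | A x /\ forall y, A y -> f x <= f y].

Definition argmax (A : set T) (f : T -> R) : set T :=
  [set x | A x /\ forall y, A y -> f y <= f x].

End Optimization.

Section DiscreteProbability.
Context {R : realType} {Z : choiceType}.

(* A discrete probability measure is given by its mass function; total mass 1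
   forces the support to be countable. *)
Definition is_discrete_probability (mu : Z -> R) : Prop :=
  (forall z, 0 <= mu z) /\ \esum_(z in [set: Z]) (mu z)%:E = 1%E.

Definition mean_well_defined (d : nat) (mu : Z -> R) (psi : Z -> 'cV[R]_d) :
    Prop :=
  forall i, summable [set: Z] (fun z => (mu z * psi z i 0)%:E).

(* The library's [\esum] is meant for nonnegative terms, hence the
   decomposition into positive and negative parts. *)
Definition mean (d : nat) (mu : Z -> R) (psi : Z -> 'cV[R]_d) : 'cV[R]_d :=
  \col_i
    (let f := fun z => (mu z * psi z i 0)%:E in
     fine (\esum_(z in [set: Z]) (f^\+)%E z)
       - fine (\esum_(z in [set: Z]) (f^\-)%E z)).

End DiscreteProbability.

Section LinearPrograms.
Context {R : realType} {X : Type} {U : finType} {d : nat}.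
Implicit Types (c : X * U -> R) (psi : X * U -> 'cV[R]_d).
Implicit Types (z : nat -> X * U) (theta b : 'cV[R]_d).

Definition Qfun psi theta (w : X * U) : R := (theta^T *m psi w) 0 0.

Definition primal_objective b theta : R := (theta^T *m b) 0 0.

(* In both programs the time index 1 <= k <= N is represented by i : 'I_N with
   k = i.+1, so that z(k-1) is [z i] and x(k) is [(z i.+1).1]. *)
Definition primal_feasible (N : nat) c psi z : set 'cV[R]_d :=
  [set theta | forall (i : 'I_N) (u : U),
     Qfun psi theta (z i) - c (z i) - Qfun psi theta ((z i.+1).1, u) <= 0].

Definition dual_objective (N : nat) c z (varpi : 'I_N -> U -> R) : R :=
  \sum_(i < N) \sum_(u : U) varpi i u * c (z i).

Definition dual_feasible (N : nat) psi z b : set ('I_N -> U -> R) :=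
  [set varpi | (forall i u, 0 <= varpi i u) /\
     \sum_(i < N) \sum_(u : U)
       varpi i u *: (psi (z i) - psi ((z i.+1).1, u)) = b].

End LinearPrograms.

(* Main.v *)
(* Complementary slackness through Farkas' lemma. At a primal optimizer theta no
   direction satisfying the homogenized active constraints increases the
   objective, so Farkas' lemma writes the objective vector as a nonnegative
   combination of the active constraint vectors. These multipliers are dual
   feasible, with dual value equal to the primal value at theta. Hence a dual
   optimizer has a value no larger than the primal one, and its weighted slacks,
   which are nonnegative, sum to at most zero: each of them vanishes. *)

Require Import Defs.
From HB Require Import structures.
From mathcomp Require Import all_boot all_order all_algebra.
From mathcomp Require Import all_classical all_reals all_analysis.
From mathcomp Require Import ring lra.

Set Implicit Arguments.
Unset Strict Implicit.
Unset Printing Implicit Defensive.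

Import Order.TTheory GRing.Theory Num.Theory.
Import numFieldNormedType.Exports.

Local Open Scope classical_set_scope.
Local Open Scope ring_scope.

Section LinearProgramming.
Context {R : realType} {d : nat}.
Implicit Types (x y v b theta : 'cV[R]_d).

Definition dot x y : R := (x^T *m y) 0 0.

Lemma dotDl x y v : dot (x + y) v = dot x v + dot y v.
Proof. by rewrite /dot linearD mulmxDl mxE. Qed.

Lemma dotZl (k : R) x v : dot (k *: x) v = k * dot x v.
Proof. by rewrite /dot linearZ -scalemxAl mxE. Qed.

Lemma dotDr x y v : dot x (y + v) = dot x y + dot x v.
Proof. by rewrite /dot mulmxDr mxE. Qed.

Lemma dotZr (k : R) x v : dot x (k *: v) = k * dot x v.
Proof. by rewrite /dot -scalemxAr mxE. Qed.

Lemma dotBr x y v : dot x (y - v) = dot x y - dot x v.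
Proof. by rewrite -scaleN1r dotDr dotZr mulN1r. Qed.

Lemma dot_sumr (J : Type) (s : seq J) (P : pred J) (f : J -> 'cV[R]_d) x :
  dot x (\sum_(j <- s | P j) f j) = \sum_(j <- s | P j) dot x (f j).
Proof. by rewrite /dot mulmx_sumr summxE. Qed.

Lemma dot_self_le0 x : dot x x <= 0 -> x = 0.
Proof.
move=> x_le0; apply/colP => i; rewrite [RHS]mxE.
have sq_ge0 (j : 'I_d) : true -> 0 <= x j 0 ^+ 2 by rewrite sqr_ge0.
have xxE : dot x x = \sum_j x j 0 ^+ 2.
  by rewrite /dot mxE; apply: eq_bigr => j _; rewrite mxE -expr2.
have /eqP : \sum_j x j 0 ^+ 2 = 0.
  by apply/eqP; rewrite eq_le sumr_ge0 // andbT -xxE.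
rewrite psumr_eq0 // => /allP /(_ i); rewrite mem_index_enum => /(_ isT).
by rewrite sqrf_eq0 => /eqP.
Qed.

(* Bartl's algebraic proof: if the first constraint [j] is not redundant, some
   [x0] satisfies the others and violates the conclusion, so [dot x0 (a j) > 0]
   and one eliminates [a j] by projecting along [x0]. *)
Lemma farkas (J : eqType) (s : seq J) (a : J -> 'cV[R]_d) b :
  uniq s ->
  (forall x, (forall j, j \in s -> dot x (a j) <= 0) -> dot x b <= 0) ->
  exists2 l : J -> R, (forall j, 0 <= l j) & b = \sum_(j <- s) l j *: a j.
Proof.
elim: s a b => [|j s IHs] a b /=.
  (* Without constraints [x = b] is admissible, so [dot b b <= 0] forces [b = 0]. *)
  move=> _ b_le0; exists (fun=> 0) => //; rewrite big_nil.
  by apply: dot_self_le0; apply: b_le0.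
move=> /andP[j_notin s_uniq] b_le0.
(* Resetting the multiplier at [j] to [t] leaves the sum over [s] unchanged, since [j] is not in
   [s]. *)
have extend (l : J -> R) (t : R) : 0 <= t -> (forall k, 0 <= l k) ->
    b = t *: a j + \sum_(k <- s) l k *: a k ->
    exists2 l' : J -> R, (forall k, 0 <= l' k)
      & b = \sum_(k <- j :: s) l' k *: a k.
  move=> t_ge0 l_ge0 bE; exists (fun k => if k == j then t else l k).
    by move=> k; case: ifP.
  rewrite big_cons eqxx bE; congr (_ + _); apply: eq_big_seq => k k_in.
  by case: eqP => // kj; move: j_notin; rewrite -kj k_in.
have [red|] := pselect (forall x,
    (forall k, k \in s -> dot x (a k) <= 0) -> dot x b <= 0).
  have [l l_ge0 bE] := IHs a b s_uniq red.
  by apply: (extend l 0) => //; rewrite scale0r add0r.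
move=> /existsNP[x0 /not_implyP[x0_le0 /negP]]; rewrite -ltNge => bx0_gt0.
set al := dot x0 (a j).
have al_gt0 : 0 < al.
  rewrite ltNge; apply/negP => al_le0; move: bx0_gt0; rewrite ltNge => /negP[].
  by apply: b_le0 => k; rewrite inE => /predU1P[->|/x0_le0].
have al_neq0 : al != 0 by rewrite gt_eqF.
(* [proj] maps onto the hyperplane orthogonal to [x0] and kills [a j]. Its adjoint shifts [x] along
   [x0] until constraint [j] is tight, so the hypothesis on [b] passes to the projected vectors,
   with [j] gone. *)
pose proj v := v - (dot x0 v / al) *: a j.
have dot_proj x v : dot x (proj v) = dot (x + (- (dot x (a j) / al)) *: x0) v.
  by rewrite /proj dotBr dotZr dotDl dotZl; field.
have [l l_ge0 bE] : exists2 l : J -> R, (forall k, 0 <= l k)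
    & proj b = \sum_(k <- s) l k *: proj (a k).
  apply: (IHs (fun k => proj (a k))) => // x x_le0.
  rewrite dot_proj; apply: b_le0 => k; rewrite inE => /predU1P[->|k_in].
    by rewrite -dot_proj /proj divff // scale1r subrr /dot mulmx0 mxE.
  by rewrite -dot_proj x_le0.
(* This coefficient of [a j] comes from expanding both sides of [bE]. It is nonnegative because
   [dot x0 b > 0] while [dot x0 (a k) <= 0] on [s]. *)
apply: (extend l (dot x0 b / al - \sum_(k <- s) l k * (dot x0 (a k) / al))) => //.
  rewrite subr_ge0; apply: (@le_trans _ _ 0); last by rewrite divr_ge0 ?ltW.
  rewrite big_seq; apply: sumr_le0 => k k_in.
  by rewrite mulr_ge0_le0 // pmulr_lle0 ?invr_gt0 // x0_le0.
have : b = (dot x0 b / al) *: a j + proj b by rewrite addrC subrK.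
rewrite bE => {1}->; rewrite scalerBl -addrA; congr (_ + _).
rewrite scaler_suml -sumrN -big_split /=; apply: eq_bigr => k _.
by rewrite scalerBr scalerA addrC.
Qed.

(** Farkas' lemma is applied to the active constraints only and the multipliers are extended by
    zero. Each [l j * c j] then equals [l j * dot theta (a j)], whence the equality of values. *)
Lemma lp_multipliers (J : finType) (a : J -> 'cV[R]_d) (c : J -> R) b theta :
  argmax [set t | forall j, dot t (a j) <= c j] (fun t => dot t b) theta ->
  exists l : J -> R, [/\ forall j, 0 <= l j, b = \sum_j l j *: a j
    & \sum_j l j * c j = dot theta b].
Proof.
move=> [feas opt]; pose active j := dot theta (a j) == c j.
have [|h h_le0|l l_ge0 bE] := @farkas J [seq j <- index_enum J | active j] a b.
- by rewrite filter_uniq // index_enum_uniq.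
(* The step [e] along [h] must not exceed the slack of any inactive constraint: [e * r j <= 1]
   ensures this. The added 1 keeps [e] positive even when all [r j] vanish; at active [j] division
   by zero gives [r j = 0]. *)
- pose r j := `|dot h (a j)| / (c j - dot theta (a j)).
  have r_ge0 j : 0 <= r j by rewrite divr_ge0 // subr_ge0 feas.
  have r_sum_ge0 : 0 <= \sum_j r j by apply: sumr_ge0.
  pose e := (1 + \sum_j r j)^-1.
  have e_gt0 : 0 < e by rewrite invr_gt0; lra.
  suff /opt : forall j, dot (theta + e *: h) (a j) <= c j.
    by rewrite dotDl dotZl gerDl pmulr_rle0.
  move=> j; rewrite dotDl dotZl; have [act|inact] := boolP (active j).
    rewrite -(eqP act) gerDl pmulr_rle0 // h_le0 //.
    by rewrite mem_filter act mem_index_enum.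
  have slack_gt0 : 0 < c j - dot theta (a j).
    by rewrite subr_gt0 lt_neqAle inact feas.
  rewrite -lerBrDl mulrC ler_pdivrMr; last by lra.
  rewrite (le_trans (ler_norm _)) // mulrC -ler_pdivrMr // -/(r j).
  rewrite (bigD1 j) //=.
  have : 0 <= \sum_(k | k != j) r k by apply: sumr_ge0.
  lra.
exists (fun j => if active j then l j else 0); split.
- by move=> j; case: ifP.
- rewrite bE big_filter big_mkcond /=; apply: eq_bigr => j _.
  by case: ifP; rewrite ?scale0r.
- rewrite bE big_filter dot_sumr [RHS]big_mkcond /=; apply: eq_bigr => j _.
  by case: ifP => [/eqP <-|_]; rewrite ?dotZr ?mul0r.
Qed.

Lemma lp_complementary_slackness (J : finType) (a : J -> 'cV[R]_d)
    (c : J -> R) b theta (w : J -> R) (j : J) :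
  argmax [set t | forall j, dot t (a j) <= c j] (fun t => dot t b) theta ->
  argmin [set l : J -> R | (forall j, 0 <= l j) /\ \sum_j l j *: a j = b]
    (fun l => \sum_j l j * c j) w ->
  0 < w j -> dot theta (a j) = c j.
Proof.
move=> theta_opt [[w_ge0 wE] w_opt] wj_gt0; have [feas _] := theta_opt.
have [l [l_ge0 bE lE]] := lp_multipliers theta_opt.
have /w_opt : (forall j, 0 <= l j) /\ \sum_j l j *: a j = b by [].
rewrite lE -wE dot_sumr -subr_le0 -sumrB => sum_le0.
have term_ge0 (k : J) : true -> 0 <= w k * c k - dot theta (w k *: a k).
  by move=> _; rewrite dotZr -mulrBr mulr_ge0 // subr_ge0 feas.
have /eqP : \sum_k (w k * c k - dot theta (w k *: a k)) = 0.
  by apply/eqP; rewrite eq_le sum_le0 sumr_ge0.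
rewrite psumr_eq0 // => /allP /(_ j); rewrite mem_index_enum => /(_ isT).
by rewrite dotZr -mulrBr mulf_eq0 gt_eqF //= subr_eq0 => /eqP ->.
Qed.

End LinearProgramming.

Theorem proposition2p5 (R : realType) (n d : nat)
  (X : set 'rV[R]_n) (X_closed : closed X) (U : finType)
  (F : X * U -> X)
  (z : nat -> X * U) (z_dyn : forall k, (z k.+1).1 = F (z k))
  (ze : X * U) (ze_eq : ze.1 = F ze)
  (c : X * U -> R) (c_ge0 : forall w, 0 <= c w) (c_ze : c ze = 0)
  (psi : X * U -> 'cV[R]_d) (psi_ze : forall i, psi ze i 0 = 0)
  (mu : X * U -> R) (mu_prob : is_discrete_probability mu)
  (mu_psi : mean_well_defined mu psi)
  (N : nat) (N_ge1 : (1 <= N)%N)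
  (theta : 'cV[R]_d)
  (theta_opt :
    argmax (primal_feasible N c psi z) (primal_objective (mean mu psi)) theta)
  (varpi : 'I_N -> U -> R)
  (varpi_opt :
    argmin (dual_feasible psi z (mean mu psi)) (dual_objective c z) varpi)
  (i : 'I_N) (u0 : U) (varpi_gt0 : 0 < varpi i u0) :
  is_min [set - Qfun psi theta (z i) + c (z i)
              + Qfun psi theta ((z i.+1).1, u) | u in [set: U]] 0
  /\ argmin [set: U] (fun u => Qfun psi theta ((z i.+1).1, u)) u0.
Proof.
(* Pairs of a time and an input index the constraints by one finite type, which turns the double
   sums into single ones. *)
pose a (p : 'I_N * U) : 'cV[R]_d :=
  psi (z p.1) - psi ((z p.1.+1).1, p.2).
have constrE t (p : 'I_N * U) : Qfun psi t (z p.1) - c (z p.1)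
    - Qfun psi t ((z p.1.+1).1, p.2) = dot t (a p) - c (z p.1).
  by rewrite dotBr addrAC.
have [feas opt] := theta_opt; have [[w_ge0 wE] w_opt] := varpi_opt.
have slack0 : dot theta (a (i, u0)) = c (z i).
  apply: (lp_complementary_slackness (a := a) (c := fun p => c (z p.1))
    (b := mean mu psi) (w := fun p => varpi p.1 p.2) (j := (i, u0))) => //.
    split=> [p|t t_feas]; first by rewrite -subr_le0 -constrE; exact: feas.
    by apply: opt => k u; rewrite (constrE t (k, u)) subr_le0 t_feas.
  split=> [|l [l_ge0 lE]].
    by split=> [p|]; [exact: w_ge0 | rewrite -wE pair_bigA].
  have /w_opt : dual_feasible psi z (mean mu psi) (fun k u => l (k, u)).
    split=> [k u|]; first exact: l_ge0.
    by rewrite pair_bigA -lE; apply: eq_bigr => -[].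
  rewrite /dual_objective !pair_bigA /= => /le_trans -> //.
  by rewrite le_eqVlt (eq_bigr (fun p => l p * c (z p.1))) ?eqxx // => -[].
(* The bracket vanishes at [u0] and is nonnegative by feasibility. Only its last term depends on
   [u], so [u0] also minimizes that term. *)
have Q0 : - Qfun psi theta (z i) + c (z i) + Qfun psi theta ((z i.+1).1, u0) = 0.
  by have := constrE theta (i, u0); rewrite slack0 /=; lra.
have Q_ge0 u :
    0 <= - Qfun psi theta (z i) + c (z i) + Qfun psi theta ((z i.+1).1, u).
  by have := feas i u; lra.
split; split=> //.
- by exists u0.
- by move=> _ [u _ <-].
- by move=> u _; have := Q_ge0 u; lra.
Qed.
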